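(* Let $\lambda\in\mathbb{C}$ and let $u:\overline\Omega\to\mathbb{C}$, $\mathbf{u}:\overline\Omega\to\mathbb{C}^{n+1}$ be (smooth) solutions on $\Omega=(0,L)$ of the eigenvalue problem $$-Ku''''+N^{\rm T}\mathbf{h}_E\mathbf{G}_E\phi_E'=\lambda^2(mu-\alpha u''),\qquad \mathbf{h}_{\mathcal{O}}\mathbf{E}_{\mathcal{O}}\mathbf{u}''-\mathbf{B}^{\rm T}\mathbf{G}_E\phi_E=\lambda^2\mathbf{p}_{\mathcal{O}}\mathbf{h}_{\mathcal{O}}\mathbf{u},\qquad \phi_E=\mathbf{h}_E^{-1}\mathbf{B}\mathbf{u}+Nu'.$$ Suppose that one of the following sets of boundary conditions holds: - (h-N): $u(0)=u''(0)=u(L)=u''(L)=u'''(L)=0$ and $\mathbf{u}'(0)=\mathbf{u}'(L)=\mathbf{u}''(L)=0$, where in addition $\int_\Omega\mathbf{u}\,dx=0$ (as required by the underlying state space); - (c-D), (m-m): $u(0)=u'(0)=u(L)=u'(L)=u''(L)=0$ and $\mathbf{u}(0)=\mathbf{u}(L)=\mathbf{u}'(L)=0$. Then the solution is trivial: $u\equiv0$ and $\mathbf{u}\equiv0$.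
   Context: $L>0$; primes denote $d/dx$. $n\ge1$; $m,\alpha,K>0$; $h_i>0$ for $i=1,\dots,2n+1$; $\rho_i,E_i>0$ for odd $i$; $G_i\ge0$ for even $i$. $\mathbf{h}_{\mathcal{O}}=\mathrm{diag}(h_1,h_3,\dots,h_{2n+1})$, $\mathbf{p}_{\mathcal{O}}=\mathrm{diag}(\rho_1,\rho_3,\dots,\rho_{2n+1})$, $\mathbf{E}_{\mathcal{O}}=\mathrm{diag}(E_1,E_3,\dots,E_{2n+1})$, $\mathbf{h}_E=\mathrm{diag}(h_2,\dots,h_{2n})$, $\mathbf{G}_E=\mathrm{diag}(G_2,\dots,G_{2n})$. $\mathbf{A}=(a_{ij})$ and $\mathbf{B}=(b_{ij})$ are the $n\times(n+1)$ matrices with $a_{ij}=1/2$, $b_{ij}=(-1)^{i+j+1}$ if $j=i$ or $j=i+1$, and $0$ otherwise. $N=\mathbf{h}_E^{-1}\mathbf{A}\mathbf{h}_{\mathcal{O}}\vec 1_{\mathcal{O}}+\vec 1_E$, where $\vec 1_{\mathcal{O}}\in\mathbb{R}^{n+1}$, $\vec 1_E\in\mathbb{R}^n$ have all entries $1$. *)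

(* Defs.v *)
From HB Require Import structures.
From mathcomp Require Import all_boot all_order all_algebra.
From mathcomp Require Import complex.
From mathcomp Require Import all_classical all_reals all_analysis.

Set Implicit Arguments.
Unset Strict Implicit.
Unset Printing Implicit Defensive.

Import Order.TTheory GRing.Theory Num.Theory.
Import numFieldNormedType.Exports.

Local Open Scope classical_set_scope.
Local Open Scope ring_scope.
Local Open Scope complex_scope.

Section Calculus.
Variables (R : realType) (L : R).

Definition diffquo (f : R -> R) (x y : R) : R := (f y - f x) / (y - x).

(* Derivative relative to the closed interval [0, L]: two-sided inside,
   one-sided at the end points, so that only the values of f on [0, L] matter.
   Where the limit does not exist (in particular outside [0, L]) the value is
   irrelevant. *)
Definition deriv_cc (f : R -> R) (x : R) : R :=
  lim (diffquo f x y @[y --> within `[0, L] x^']).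

(* f is C^oo on [0, L], up to the end points. *)
Definition smooth_cc (f : R -> R) : Prop :=
  forall (k : nat) (x : R), x \in `[0, L] ->
    cvg (diffquo (iter k deriv_cc f) x y @[y --> within `[0, L] x^']).

Definition cderiv (f : R -> R[i]) (x : R) : R[i] :=
  deriv_cc (fun t => complex.Re (f t)) x +i*
  deriv_cc (fun t => complex.Im (f t)) x.

Definition csmooth (f : R -> R[i]) : Prop :=
  smooth_cc (fun t => complex.Re (f t)) /\
  smooth_cc (fun t => complex.Im (f t)).

Definition vderiv p (F : R -> 'cV[R[i]]_p) (x : R) : 'cV[R[i]]_p :=
  \col_i cderiv (fun t => F t i 0) x.

Definition vsmooth p (F : R -> 'cV[R[i]]_p) : Prop :=
  forall i, csmooth (fun t => F t i 0).

Definition vintegral p (F : R -> 'cV[R[i]]_p) : 'cV[R[i]]_p :=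
  \col_i (Rintegral lebesgue_measure `]0, L[ (fun t => complex.Re (F t i 0)) +i*
          Rintegral lebesgue_measure `]0, L[ (fun t => complex.Im (F t i 0))).

End Calculus.

Notation toC := (map_mx (real_complex _)).

(* Layers are numbered 1, ..., 2n+1: a layer-dependent coefficient is a function
   on nat of which only those values are used. The 0-based index k stands for
   the odd layer 2k+1 in diagO and for the even layer 2k+2 in diagE. *)
Section Matrices.
Variables (R : realType) (n : nat).

Definition diagO (c : nat -> R) : 'M[R]_n.+1 :=
  diag_mx (\row_(k < n.+1) c k.*2.+1).

Definition diagE (c : nat -> R) : 'M[R]_n :=
  diag_mx (\row_(k < n) c k.*2.+2).

Definition onesO : 'cV[R]_n.+1 := const_mx 1.

Definition onesE : 'cV[R]_n := const_mx 1.

Definition matA : 'M[R]_(n, n.+1) :=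
  \matrix_(i < n, j < n.+1)
    if (j == i :> nat) || (j == i.+1 :> nat) then 2^-1 else 0.

(* The sign is (-1)^(i+j+1) for the 1-based indices i.+1 and j.+1. *)
Definition matB : 'M[R]_(n, n.+1) :=
  \matrix_(i < n, j < n.+1)
    if (j == i :> nat) || (j == i.+1 :> nat)
    then (-1) ^+ (i.+1 + j.+1 + 1) else 0.

Definition vecN (h : nat -> R) : 'cV[R]_n :=
  invmx (diagE h) *m matA *m diagO h *m onesO + onesE.

Definition phiE (L : R) (h : nat -> R)
    (u : R -> R[i]) (U : R -> 'cV[R[i]]_n.+1) (x : R) : 'cV[R[i]]_n :=
  toC (invmx (diagE h) *m matB) *m U x + cderiv L u x *: toC (vecN h).

End Matrices.

Arguments diagO {R} n c.
Arguments diagE {R} n c.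
Arguments matB R n : clear implicits.
Arguments matA R n : clear implicits.
Arguments vecN {R} n h.

(* Main.v *)
(* Write w = (u', U), s = u and let z be the resultant
   N^T h_E G_E phi_E + lambda^2 alpha u' - K u'''; both equations together become
     D w'' = (C + lambda^2 M) w - z e,  s' = e . w,  z' = lambda^2 m s
   with constant symmetric matrices, D, M positive definite, C positive
   semidefinite. Under both sets of boundary conditions the flux
   w^* D w' + conj(s) z vanishes at 0 and L, while its derivative is
   (w'^* D w' + w^* C w) + lambda^2 (w^* M w + m |s|^2); hence either the solution
   is trivial or lambda^2 is real and nonpositive, in which case all real-linear
   functionals of the solution solve the same real system. Then
     H = w' . D w' - w . (C + lambda^2 M) w - lambda^2 m s^2 + 2 z (e . w)
   is constant in x. If w, w', s vanish at L then H = 0, so that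
   (w . D w' - z s)' = 2 (w' . D w' - lambda^2 m s^2) >= 0; when this flux also
   vanishes at 0, w' = 0. For the clamped conditions this applies to (w, s, z),
   for the hinged ones to the second derivatives (w'', s'', z''). *)

Require Import Defs.
From mathcomp Require Import all_boot all_order all_algebra.
From mathcomp Require Import complex.
From mathcomp Require Import all_classical all_reals all_analysis.
From mathcomp Require Import ring lra zify.

Set Implicit Arguments.
Unset Strict Implicit.
Unset Printing Implicit Defensive.

Import Order.TTheory GRing.Theory Num.Theory.
Import numFieldNormedType.Exports.

Local Open Scope classical_set_scope.
Local Open Scope ring_scope.
Local Open Scope complex_scope.

(** * Derivatives relative to a closed interval *)

Section DerivativeOnSegment.
Variables (R : realType) (L : R).
Hypothesis L_gt0 : 0 < L.
Implicit Types (f g : R -> R) (x a : R).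

Local Notation punctured x := (within `[0, L] x^').

(** As a relation it carries the existence of the limit, so the arbitrary value of a divergent [lim]
    never enters a computation. *)
Definition is_deriv_cc f f' : Prop :=
  forall x, x \in `[0, L] -> diffquo f x y @[y --> punctured x] --> f' x.

(** Since [0 < L], each point of the segment is an accumulation point of it; uniqueness of the
    limits, one-sided ones included, rests on this. *)
Lemma punctured_proper x : x \in `[0, L] -> ProperFilter (punctured x).
Proof.
rewrite in_itv/= => /andP[x_ge0 x_leL].
apply: Build_ProperFilter_ex => P /nbhs_ballP[e /= e_gt0 eP].
have [xL|Lx] := ltP x L.
(* The nearby point lies to the right of [x] if [x < L] and to the left otherwise; halving the
   minimum makes the distance strictly less than [e]. *)
- pose t := Num.min e (L - x) / 2.
  have t_gt0 : 0 < t by rewrite divr_gt0// lt_min e_gt0 subr_gt0.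
  have te : t < e.
    by rewrite ltr_pdivrMr// gt_min; apply/orP; left; lra.
  have tL : t <= L - x.
    by rewrite ler_pdivrMr// ge_min; apply/orP; right; lra.
  exists (x + t); apply: eP.
  + by rewrite /ball/= opprD addNKr normrN gtr0_norm.
  + by rewrite gt_eqF//; lra.
  + by rewrite /= in_itv/=; apply/andP; split; lra.
- pose t := Num.min e L / 2.
  have t_gt0 : 0 < t by rewrite divr_gt0// lt_min e_gt0.
  have te : t < e.
    by rewrite ltr_pdivrMr// gt_min; apply/orP; left; lra.
  have tL : t <= L.
    by rewrite ler_pdivrMr// ge_min; apply/orP; right; lra.
  exists (x - t); apply: eP.
  + by rewrite /ball/= opprB addrCA subrr addr0 gtr0_norm.
  + by rewrite lt_eqF//; lra.
  + by rewrite /= in_itv/=; apply/andP; split; lra.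
Qed.

Lemma is_deriv_cc_cvg f f' x : is_deriv_cc f f' -> x \in `[0, L] ->
  f y @[y --> punctured x] --> f x.
Proof.
move=> ff' xL; have PF := punctured_proper xL.
have id_cvg : (fun y => y - x) @ punctured x --> (0 : R).
  rewrite -(subrr x); apply: cvgB; last exact: cvg_cst.
  apply: (cvg_trans (@cvg_within _ _ _ _)); exact: cvg_within.
have : (fun y => diffquo f x y * (y - x) + f x) @ punctured x -->
    f' x * 0 + f x.
  by apply: cvgD; [exact: cvgM (ff' x xL) id_cvg|exact: cvg_cst].
rewrite mulr0 add0r; apply: cvg_trans; apply: near_eq_cvg.
apply: cvg_within; near=> y.
by rewrite /diffquo divfK ?addrNK// subr_eq0; near: y; exact: nbhs_dnbhs_neq.
Unshelve. all: by end_near.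
Qed.

Lemma is_deriv_cc_unique f f1 f2 : is_deriv_cc f f1 -> is_deriv_cc f f2 ->
  {in `[0, L], f1 =1 f2}.
Proof.
move=> ff1 ff2 x xL; have PF := punctured_proper xL.
exact: cvg_unique (ff1 x xL) (ff2 x xL).
Qed.

Lemma deriv_ccE f f' : is_deriv_cc f f' -> {in `[0, L], deriv_cc L f =1 f'}.
Proof.
move=> ff' x xL; have PF := punctured_proper xL.
by apply: cvg_lim; [exact: Rhausdorff|exact: ff'].
Qed.

Lemma eq_is_deriv_cc f f1 f2 : {in `[0, L], f1 =1 f2} ->
  is_deriv_cc f f1 -> is_deriv_cc f f2.
Proof. by move=> e12 ff1 x xL; rewrite -e12//; exact: ff1. Qed.

Lemma eq_is_deriv_ccl f g f' : {in `[0, L], f =1 g} ->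
  is_deriv_cc f f' -> is_deriv_cc g f'.
Proof.
move=> fg ff' x xL; apply: cvg_trans (ff' x xL); apply: near_eq_cvg.
rewrite near_withinE; apply: nearW => y yL.
by rewrite /diffquo !fg.
Qed.

Lemma is_deriv_cc_cst a : is_deriv_cc (fun=> a) (fun=> 0).
Proof.
move=> x xL; have PF := punctured_proper xL.
rewrite (_ : diffquo _ _ = cst 0); first exact: cvg_cst.
by apply/funext => y; rewrite /diffquo subrr mul0r.
Qed.

Lemma is_deriv_ccD f f' g g' : is_deriv_cc f f' -> is_deriv_cc g g' ->
  is_deriv_cc (fun x => f x + g x) (fun x => f' x + g' x).
Proof.
move=> ff' gg' x xL; have PF := punctured_proper xL.
rewrite (_ : diffquo _ _ = diffquo f x \+ diffquo g x).
  exact: cvgD (ff' x xL) (gg' x xL).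
by apply/funext => y; rewrite /diffquo /= -mulrDl; congr (_ / _); ring.
Qed.

Lemma is_deriv_ccM f f' g g' : is_deriv_cc f f' -> is_deriv_cc g g' ->
  is_deriv_cc (fun x => f x * g x) (fun x => f' x * g x + f x * g' x).
Proof.
move=> ff' gg' x xL; have PF := punctured_proper xL.
rewrite (_ : diffquo _ _ =
    (fun y => diffquo f x y * g y + f x * diffquo g x y)); last first.
  by apply/funext => y; rewrite /diffquo; ring.
apply: cvgD; first exact: cvgM (ff' x xL) (is_deriv_cc_cvg gg' xL).
exact: cvgM (cvg_cst _) (gg' x xL).
Qed.

Lemma is_deriv_ccZ a f f' : is_deriv_cc f f' ->
  is_deriv_cc (fun x => a * f x) (fun x => a * f' x).
Proof.
move=> ff'; apply: eq_is_deriv_cc (is_deriv_ccM (is_deriv_cc_cst a) ff').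
by move=> x _ /=; rewrite mul0r add0r.
Qed.

Lemma is_deriv_ccN f f' : is_deriv_cc f f' ->
  is_deriv_cc (fun x => - f x) (fun x => - f' x).
Proof.
move=> ff'; have := @is_deriv_ccZ (-1) _ _ ff'.
have NE g : (fun x => -1 * g x) = (fun x => - g x).
  by apply/funext => x; rewrite mulN1r.
by rewrite !NE.
Qed.

Lemma is_deriv_ccB f f' g g' : is_deriv_cc f f' -> is_deriv_cc g g' ->
  is_deriv_cc (fun x => f x - g x) (fun x => f' x - g' x).
Proof. by move=> ff' /is_deriv_ccN; exact: is_deriv_ccD. Qed.

Lemma is_deriv_cc_sum (I : Type) (r : seq I) (F F' : I -> R -> R) :
  (forall i, is_deriv_cc (F i) (F' i)) ->
  is_deriv_cc (fun x => \sum_(i <- r) F i x) (fun x => \sum_(i <- r) F' i x).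
Proof.
move=> FF'; elim: r => [|i r IHr].
  apply: (@eq_is_deriv_ccl (fun=> 0)) => [x _|]; first by rewrite big_nil.
  apply: eq_is_deriv_cc (is_deriv_cc_cst 0) => x _; by rewrite big_nil.
apply: eq_is_deriv_ccl => [x _|]; first by rewrite big_cons.
by apply: eq_is_deriv_cc (is_deriv_ccD (FF' i) IHr) => x _; rewrite big_cons.
Qed.

Lemma smooth_is_deriv_cc f k : smooth_cc L f ->
  is_deriv_cc (iter k (deriv_cc L) f) (iter k.+1 (deriv_cc L) f).
Proof. by move=> fs x xL; exact: fs. Qed.

(** Extends the differential equations, assumed on the open interval only, to the end points: [f] is
    continuous, and close to any point of the segment the other points of the segment are
    interior. *)
Lemma is_deriv_cc_eq_cc f f' c : is_deriv_cc f f' ->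
  {in `]0, L[, forall x, f x = c} -> {in `[0, L], forall x, f x = c}.
Proof.
move=> ff' fc x xL; have PF := punctured_proper xL.
apply: (cvg_unique (@Rhausdorff R) (is_deriv_cc_cvg ff' xL)).
apply: cvg_near_cst; rewrite near_withinE.
have [x0|x0] := eqVneq x 0; last have [xL'|xL'] := eqVneq x L.
- near=> y => yL; apply: fc; rewrite in_itv/=.
  have yx : y != x by near: y; exact: nbhs_dnbhs_neq.
  have yltL : y < L.
    near: y; apply: nbhs_dnbhs; apply: lt_nbhsl; by rewrite x0.
  by move: yL; rewrite /= in_itv/= yltL andbT lt_def -x0 yx/= => /andP[].
- near=> y => yL; apply: fc; rewrite in_itv/=.
  have yx : y != x by near: y; exact: nbhs_dnbhs_neq.
  have y0 : 0 < y.
    near: y; apply: nbhs_dnbhs; apply: lt_nbhsr; by rewrite xL'.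
  by move: yL; rewrite /= in_itv/= y0 /= lt_def eq_sym -xL' yx/= => /andP[].
- near=> y => yL; apply: fc; near: y; apply: nbhs_dnbhs.
  apply: near_in_itvoo.
  by move: xL; rewrite !in_itv/= !lt_def x0 eq_sym xL'.
Unshelve. all: by end_near.
Qed.

Lemma is_deriv_cc_continuous f f' : is_deriv_cc f f' ->
  {within `[0, L], continuous f}.
Proof.
move=> ff'; apply/subspace_continuousP => x xL P Pfx.
have := is_deriv_cc_cvg ff' xL Pfx.
rewrite /nbhs/= /within/= !near_simpl => h.
near=> y => yL; have [->|yx] := eqVneq y x; first exact: nbhs_singleton.
by move: yx yL; near: y.
Unshelve. all: by end_near.
Qed.

(** Around an interior point small increments stay in the segment, so the relative limit is the
    usual two-sided one. This gives access to the monotonicity criterion [ger0_derive1_ndecr]. *)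
Lemma is_deriv_cc_is_derive f f' x : is_deriv_cc f f' -> x \in `]0, L[ ->
  is_derive x 1 f (f' x).
Proof.
move=> ff' xL.
suff : h^-1 *: (f (h *: 1 + x) - f x) @[h --> 0^'] --> f' x.
  move=> h; split; first by apply/cvg_ex; exists (f' x).
  by apply: cvg_lim => //; exact: Rhausdorff.
have shift_cvg : h + x @[h --> 0^'] --> punctured x.
  move=> P /nbhs_ballP[e /= e_gt0 eP].
  have /nbhs_ballP[d /= d_gt0 dL] := near_in_itvoo xL.
  have shift_ball r h : ball 0 r h -> ball x r (h + x).
    by rewrite /ball/= sub0r normrN opprD addrCA subrr addr0 normrN.
  apply/nbhs_ballP; exists (Num.min d e) => /=; first by rewrite lt_min d_gt0.
  move=> h hball h_neq0.
  have [hd he] : ball 0 d h /\ ball 0 e h.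
    by move: hball; rewrite /ball/= lt_min => /andP[].
  apply: eP; first exact: shift_ball.
  - by rewrite -subr_eq0 addrK.
  - exact: subset_itv_oo_cc (dL _ (shift_ball _ _ hd)).
have xLc : x \in `[0, L] by apply: subset_itv_oo_cc xL.
have := cvg_comp _ _ shift_cvg (ff' x xLc); apply: cvg_trans.
apply: near_eq_cvg; apply: nearW => h /=.
by rewrite /diffquo addrK scaler1 mulrC.
Qed.

Lemma is_deriv_cc_ndecr f f' : is_deriv_cc f f' ->
  {in `[0, L], forall x, 0 <= f' x} ->
  {in `[0, L] &, {homo f : x y / x <= y}}.
Proof.
move=> ff' f'_ge0 x y; rewrite !in_itv/= => /andP[x0 _] /andP[_ yL] xy.
apply: (@ger0_derive1_ndecr _ f 0 L) => //.
- by move=> z zL; have [] := is_deriv_cc_is_derive ff' zL.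
- move=> z zL; rewrite derive1E.
  have [_ ->] := is_deriv_cc_is_derive ff' zL.
  by apply: f'_ge0; apply: subset_itv_oo_cc zL.
- exact: is_deriv_cc_continuous ff'.
Qed.

(** A nondecreasing function with equal end values is constant. Each flux argument below ends with
    this lemma. *)
Lemma is_deriv_cc_ge0_eq0 f f' : is_deriv_cc f f' ->
  {in `[0, L], forall x, 0 <= f' x} -> f 0 = f L ->
  {in `[0, L], forall x, f' x = 0}.
Proof.
move=> ff' f'_ge0 f0L.
have fE x : x \in `[0, L] -> f 0 = f x.
  move=> xL; apply/le_anti; rewrite {2}f0L.
  have /andP[x0 xleL] := xL.
  by rewrite !(is_deriv_cc_ndecr ff')// in_itv/= lexx// ltW.
apply: is_deriv_cc_unique ff' _.
exact: eq_is_deriv_ccl fE (is_deriv_cc_cst _).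
Qed.

Lemma is_deriv_cc0 f f' : is_deriv_cc f f' ->
  {in `[0, L], forall x, f' x = 0} -> {in `[0, L] &, forall x y, f x = f y}.
Proof.
move=> ff' f'0 x y xL yL.
wlog : x y xL yL / x <= y => [H|xley].
  by have [/H->|/ltW/H->] := leP x y.
apply/le_anti; rewrite (is_deriv_cc_ndecr ff')//=; last first.
  by move=> z zL; rewrite f'0.
rewrite -lerN2 (is_deriv_cc_ndecr (is_deriv_ccN ff'))//.
by move=> z zL; rewrite f'0// oppr0.
Qed.
End DerivativeOnSegment.

(** * Dot product and positive quadratic forms *)

Section DotProduct.
Variables (R : realType) (p : nat).
Implicit Types (v w : 'cV[R]_p) (S : 'M[R]_p).

Definition dot v w : R := (v^T *m w) 0 0.

Lemma dotE v w : dot v w = \sum_i v i 0 * w i 0.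
Proof. by rewrite /dot mxE; apply: eq_bigr => i _; rewrite mxE. Qed.

Lemma dotC v w : dot v w = dot w v.
Proof. by rewrite !dotE; apply: eq_bigr => i _; rewrite mulrC. Qed.

Lemma dotDr u v w : dot u (v + w) = dot u v + dot u w.
Proof. by rewrite /dot mulmxDr mxE. Qed.

Lemma dotNr u v : dot u (- v) = - dot u v.
Proof. by rewrite /dot mulmxN mxE. Qed.

Lemma dotZr a u v : dot u (a *: v) = a * dot u v.
Proof. by rewrite /dot -scalemxAr mxE. Qed.

Lemma dot0l v : dot 0 v = 0.
Proof. by rewrite /dot trmx0 mul0mx mxE. Qed.

Lemma dot0r v : dot v 0 = 0.
Proof. by rewrite dotC dot0l. Qed.

Lemma dot_sym S v w : S^T = S -> dot v (S *m w) = dot w (S *m v).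
Proof. by move=> ST; rewrite [RHS]dotC /dot trmx_mul ST mulmxA. Qed.

Definition possemidef S := forall v, 0 <= dot v (S *m v).

Definition posdef S := forall v, v != 0 -> 0 < dot v (S *m v).

Lemma posdef_semi S : posdef S -> possemidef S.
Proof.
move=> Sp v; have [->|/Sp/ltW//] := eqVneq v 0.
by rewrite dot0l.
Qed.

Lemma posdef_eq0 S v : posdef S -> dot v (S *m v) = 0 -> v = 0.
Proof. by move=> Sp /eqP; apply: contraTeq => /Sp /gt_eqF ->. Qed.

Lemma posdef_diag (d : 'rV[R]_p) : (forall i, 0 < d 0 i) -> posdef (diag_mx d).
Proof.
move=> d_gt0 v /cV0Pn[k vk_neq0].
have vE i : v i 0 * (diag_mx d *m v) i 0 = d 0 i * v i 0 ^+ 2.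
  by rewrite mul_diag_mx mxE; ring.
rewrite dotE (bigD1 k)//= ltr_wpDr//.
  by apply: sumr_ge0 => i _; rewrite vE mulr_ge0 ?sqr_ge0 ?ltW.
by rewrite vE mulr_gt0 ?d_gt0// exprn_even_gt0.
Qed.

Lemma possemidef_diag (d : 'rV[R]_p) :
  (forall i, 0 <= d 0 i) -> possemidef (diag_mx d).
Proof.
move=> d_ge0 v; rewrite dotE; apply: sumr_ge0 => i _.
by rewrite mul_diag_mx mxE mulrCA mulr_ge0// -expr2 sqr_ge0.
Qed.

End DotProduct.

(** * Componentwise derivatives of vector functions *)

Section VectorDerivative.
Variables (R : realType) (L : R).
Hypothesis L_gt0 : 0 < L.

Definition is_vderiv_cc p (F F' : R -> 'cV[R]_p) : Prop :=
  forall i, is_deriv_cc L (fun x => F x i 0) (fun x => F' x i 0).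

Section Rules.
Variables (p : nat).
Implicit Types F G : R -> 'cV[R]_p.

Lemma is_deriv_cc_dot F F' G G' : is_vderiv_cc F F' -> is_vderiv_cc G G' ->
  is_deriv_cc L (fun x => dot (F x) (G x))
    (fun x => dot (F' x) (G x) + dot (F x) (G' x)).
Proof.
move=> FF' GG'; apply: eq_is_deriv_ccl => [x _|]; first by rewrite dotE.
apply: eq_is_deriv_cc (is_deriv_cc_sum L_gt0 _) => [x _|i]; last first.
  exact: is_deriv_ccM (FF' i) (GG' i).
by rewrite !dotE -big_split.
Qed.

Lemma is_vderiv_cc_mulmx q (A : 'M[R]_(q, p)) F F' : is_vderiv_cc F F' ->
  is_vderiv_cc (fun x => A *m F x) (fun x => A *m F' x).
Proof.
move=> FF' i; apply: eq_is_deriv_ccl => [x _|]; first by rewrite mxE.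
apply: eq_is_deriv_cc (is_deriv_cc_sum L_gt0 _) => [x _|j]; last first.
  exact: is_deriv_ccZ (FF' j).
by rewrite mxE.
Qed.

Lemma is_deriv_cc_dotl (e : 'cV[R]_p) F F' : is_vderiv_cc F F' ->
  is_deriv_cc L (fun x => dot e (F x)) (fun x => dot e (F' x)).
Proof. by move=> /(is_vderiv_cc_mulmx (A := e^T))/(_ 0). Qed.

Lemma is_vderiv_ccZ (e : 'cV[R]_p) f f' : is_deriv_cc L f f' ->
  is_vderiv_cc (fun x => f x *: e) (fun x => f' x *: e).
Proof.
move=> ff' i; apply: eq_is_deriv_ccl => [x _|]; first by rewrite mxE.
by apply: eq_is_deriv_cc (is_deriv_ccM L_gt0 ff' (is_deriv_cc_cst L_gt0 _)) => // x _;
  rewrite mulr0 addr0 mxE.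
Qed.

Lemma is_vderiv_ccB F F' G G' : is_vderiv_cc F F' -> is_vderiv_cc G G' ->
  is_vderiv_cc (fun x => F x - G x) (fun x => F' x - G' x).
Proof.
move=> FF' GG' i; apply: eq_is_deriv_ccl => [x _|]; first by rewrite !mxE.
by apply: eq_is_deriv_cc (is_deriv_ccB L_gt0 (FF' i) (GG' i)) => x _;
  rewrite !mxE.
Qed.

Lemma is_vderiv_cc_unique F F1 F2 : is_vderiv_cc F F1 -> is_vderiv_cc F F2 ->
  {in `[0, L], F1 =1 F2}.
Proof.
move=> FF1 FF2 x xL; apply/colP => i.
exact: is_deriv_cc_unique (FF1 i) (FF2 i) x xL.
Qed.

Lemma eq_is_vderiv_ccl F G F' : {in `[0, L], F =1 G} ->
  is_vderiv_cc F F' -> is_vderiv_cc G F'.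
Proof. by move=> FG FF' i; apply: eq_is_deriv_ccl (FF' i) => x /FG ->. Qed.

Lemma is_vderiv_cc0 F F' : is_vderiv_cc F F' ->
  {in `[0, L], forall x, F' x = 0} -> {in `[0, L] &, forall x y, F x = F y}.
Proof.
move=> FF' F'0 x y xL yL; apply/colP => i.
by apply: (is_deriv_cc0 L_gt0 (FF' i)) => // z zL; rewrite F'0// mxE.
Qed.

End Rules.
End VectorDerivative.

(** * The abstract second-order system *)

Section QuadraticSystem.
Variables (R : realType) (L : R) (p : nat).
Hypothesis L_gt0 : 0 < L.
Variables (D C M : 'M[R]_p) (e : 'cV[R]_p) (m : R).
Hypotheses (D_sym : D^T = D) (D_pos : posdef D).
Hypotheses (C_sym : C^T = C) (C_pos : possemidef C).
Hypotheses (M_sym : M^T = M) (M_pos : posdef M) (m_gt0 : 0 < m).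

Let zeroL : 0 \in `[0, L]. Proof. by rewrite in_itv/= lexx ltW. Qed.
Let LL : L \in `[0, L]. Proof. by rewrite in_itv/= lexx ltW. Qed.

(** Here [v + i w], [s + i t], [y + i z] are the complex state, deflection and resultant, and
    [a + i b] is the squared eigenvalue. The flux vanishes at both ends; its imaginary part has
    derivative [b * N], its real part [P + a * N], so [b != 0] or [a > 0] forces [N = 0]. *)
Lemma spectrum_real_le0 (a b : R) (v v1 v2 w w1 w2 : R -> 'cV[R]_p)
    (s t y z : R -> R) :
  is_vderiv_cc L v v1 -> is_vderiv_cc L v1 v2 ->
  is_vderiv_cc L w w1 -> is_vderiv_cc L w1 w2 ->
  is_deriv_cc L s (fun x => dot e (v x)) ->
  is_deriv_cc L t (fun x => dot e (w x)) ->
  is_deriv_cc L y (fun x => m * (a * s x - b * t x)) ->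
  is_deriv_cc L z (fun x => m * (a * t x + b * s x)) ->
  {in `[0, L], forall x, D *m v2 x =
     C *m v x + (a *: (M *m v x) - b *: (M *m w x)) - y x *: e} ->
  {in `[0, L], forall x, D *m w2 x =
     C *m w x + (a *: (M *m w x) + b *: (M *m v x)) - z x *: e} ->
  (forall x, x = 0 \/ x = L -> [/\ s x = 0, t x = 0 &
     (v x = 0 /\ w x = 0) \/ (v1 x = 0 /\ w1 x = 0)]) ->
  (b = 0 /\ a <= 0) \/
  {in `[0, L], forall x, [/\ s x = 0, t x = 0, v x = 0 & w x = 0]}.
Proof.
move=> vv1 v12 ww1 w12 ss' tt' yy' zz' Dv2 Dw2 bc.
(* [P] and [N] are the two brackets in the derivative of the flux, each summed over real and
   imaginary parts. *)
pose N x := dot (v x) (M *m v x) + dot (w x) (M *m w x)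
  + m * (s x ^+ 2 + t x ^+ 2).
pose P x := dot (v1 x) (D *m v1 x) + dot (w1 x) (D *m w1 x)
  + (dot (v x) (C *m v x) + dot (w x) (C *m w x)).
have N_ge0 x : 0 <= N x.
  rewrite /N !addr_ge0 ?(posdef_semi M_pos)// mulr_ge0 ?(ltW m_gt0)//.
  by rewrite addr_ge0 ?sqr_ge0.
have P_ge0 x : 0 <= P x.
  by rewrite /P !addr_ge0 ?(posdef_semi D_pos).
have N_eq0 : {in `[0, L], forall x, N x = 0} ->
    {in `[0, L], forall x, [/\ s x = 0, t x = 0, v x = 0 & w x = 0]}.
  move=> N0 x /N0 /eqP.
  have [vM wM] : 0 <= dot (v x) (M *m v x) /\ 0 <= dot (w x) (M *m w x).
    by split; exact: posdef_semi.
  rewrite /N !paddr_eq0 ?addr_ge0 ?mulr_ge0 ?addr_ge0 ?sqr_ge0 ?(ltW m_gt0)//.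
  rewrite mulf_eq0 (gt_eqF m_gt0)/= paddr_eq0 ?sqr_ge0// !sqrf_eq0.
  move=> /andP[/andP[/eqP/(posdef_eq0 M_pos) -> /eqP/(posdef_eq0 M_pos) ->]].
  by move=> /andP[/eqP -> /eqP ->].
(* Imaginary and real parts of the flux [w^* D w' + conj(s) z] of the header. *)
pose Tim x := dot (v x) (D *m w1 x) - dot (w x) (D *m v1 x)
  + (s x * z x - t x * y x).
pose Tre x := dot (v x) (D *m v1 x) + dot (w x) (D *m w1 x)
  + (s x * y x + t x * z x).
have dTim : is_deriv_cc L Tim (fun x => b * N x).
  have dD F F1 G G1 : is_vderiv_cc L F F1 -> is_vderiv_cc L G G1 ->
      is_deriv_cc L (fun x => dot (F x) (D *m G x))
       (fun x => dot (F1 x) (D *m G x) + dot (F x) (D *m G1 x)).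
    by move=> FF1 /(is_vderiv_cc_mulmx (A := D) L_gt0); exact: is_deriv_cc_dot.
  apply: eq_is_deriv_cc (is_deriv_ccD L_gt0
    (is_deriv_ccB L_gt0 (dD _ _ _ _ vv1 w12) (dD _ _ _ _ ww1 v12))
    (is_deriv_ccB L_gt0 (is_deriv_ccM L_gt0 ss' zz')
       (is_deriv_ccM L_gt0 tt' yy'))) => x xL.
  rewrite Dv2// Dw2// !(dotDr, dotNr, dotZr) /N.
  rewrite (dot_sym (w1 x) _ D_sym) (dot_sym (w x) (v x) C_sym).
  rewrite (dot_sym (w x) (v x) M_sym) (dotC (v x) e) (dotC (w x) e).
  by ring.
have dTre : is_deriv_cc L Tre (fun x => P x + a * N x).
  have dD F F1 G G1 : is_vderiv_cc L F F1 -> is_vderiv_cc L G G1 ->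
      is_deriv_cc L (fun x => dot (F x) (D *m G x))
       (fun x => dot (F1 x) (D *m G x) + dot (F x) (D *m G1 x)).
    by move=> FF1 /(is_vderiv_cc_mulmx (A := D) L_gt0); exact: is_deriv_cc_dot.
  apply: eq_is_deriv_cc (is_deriv_ccD L_gt0
    (is_deriv_ccD L_gt0 (dD _ _ _ _ vv1 v12) (dD _ _ _ _ ww1 w12))
    (is_deriv_ccD L_gt0 (is_deriv_ccM L_gt0 ss' yy')
       (is_deriv_ccM L_gt0 tt' zz'))) => x xL.
  rewrite Dv2// Dw2// !(dotDr, dotNr, dotZr) /N /P.
  rewrite (dot_sym (w x) (v x) M_sym) (dotC (v x) e) (dotC (w x) e).
  by ring.
have T0 x : x = 0 \/ x = L -> Tim x = 0 /\ Tre x = 0.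
  move=> /bc[s0 t0 h]; rewrite /Tim /Tre s0 t0.
  by case: h => -[-> ->]; rewrite ?mulmx0 ?(dot0l, dot0r) !mul0r !(subr0, addr0).
have [Tim0 Tre0] := T0 0 (or_introl erefl).
have [TimL TreL] := T0 L (or_intror erefl).
have [b0|b_neq0] := eqVneq b 0; last first.
  right; apply: N_eq0 => x xL.
  (* Multiplying the flux by [b] makes its derivative nonnegative whatever the sign of [b]. *)
  have /(_ x xL)/eqP : {in `[0, L], forall x, b * (b * N x) = 0}.
    apply: (is_deriv_cc_ge0_eq0 L_gt0 (is_deriv_ccZ (a := b) L_gt0 dTim)).
    - by move=> y' _; rewrite mulrA mulr_ge0// -expr2 sqr_ge0.
    - by rewrite Tim0 TimL.
  by rewrite !mulf_eq0 (negPf b_neq0)/= => /eqP.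
have [a_le0|a_gt0] := leP a 0; [by left|right].
apply: N_eq0 => x xL.
have /(_ x xL)/eqP : {in `[0, L], forall x, P x + a * N x = 0}.
  apply: (is_deriv_cc_ge0_eq0 L_gt0 dTre); last by rewrite Tre0 TreL.
  by move=> y' _; rewrite addr_ge0// mulr_ge0// ltW.
rewrite paddr_eq0 ?mulr_ge0 ?(ltW a_gt0)// mulf_eq0 (gt_eqF a_gt0)/=.
by move=> /andP[_ /eqP].
Qed.

Variable a : R.
Hypothesis a_le0 : a <= 0.

(** The resultant [z] is unconstrained at the ends: in [H] it is multiplied by [dot e (v x)], in the
    flux [W] by [s x], and these vanish where needed. The extra condition at [L], where both [v] and
    [v1] vanish, fixes the constant value of [H] as zero; at [0] one of the two suffices for the
    flux. *)
Lemma hamiltonian_rigidity (v v1 v2 : R -> 'cV[R]_p) (s z : R -> R) :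
  is_vderiv_cc L v v1 -> is_vderiv_cc L v1 v2 ->
  is_deriv_cc L s (fun x => dot e (v x)) ->
  is_deriv_cc L z (fun x => m * (a * s x)) ->
  {in `[0, L], forall x, D *m v2 x = (C + a *: M) *m v x - z x *: e} ->
  s 0 = 0 -> v 0 = 0 \/ v1 0 = 0 -> s L = 0 -> v L = 0 -> v1 L = 0 ->
  {in `[0, L], forall x, v1 x = 0}.
Proof.
move=> vv1 v12 ss' zz' Dv2 s0 v0 sL vL v1L.
pose A := C + a *: M.
have A_sym : A^T = A by rewrite /A linearD linearZ /= C_sym M_sym.
(* A first integral: the last term compensates both the coupling [z x *: e] in the equation and the
   derivative of the [s] term. *)
pose H x := dot (v1 x) (D *m v1 x) - dot (v x) (A *m v x)
  - m * a * (s x * s x) + 2 * (dot e (v x) * z x).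
have dS (S : 'M[R]_p) F F1 G G1 : is_vderiv_cc L F F1 -> is_vderiv_cc L G G1 ->
    is_deriv_cc L (fun x => dot (F x) (S *m G x))
      (fun x => dot (F1 x) (S *m G x) + dot (F x) (S *m G1 x)).
  by move=> FF1 /(is_vderiv_cc_mulmx (A := S) L_gt0); exact: is_deriv_cc_dot.
have dev := is_deriv_cc_dotl (e := e) L_gt0 vv1.
have dH : is_deriv_cc L H (fun=> 0).
  apply: eq_is_deriv_cc (is_deriv_ccD L_gt0 (is_deriv_ccB L_gt0
    (is_deriv_ccB L_gt0 (dS D _ _ _ _ v12 v12) (dS A _ _ _ _ vv1 vv1))
    (is_deriv_ccZ (a := m * a) L_gt0 (is_deriv_ccM L_gt0 ss' ss')))
    (is_deriv_ccZ (a := 2) L_gt0 (is_deriv_ccM L_gt0 dev zz'))) => x xL.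
  rewrite (dot_sym (v2 x) _ D_sym) Dv2// !(dotDr, dotNr, dotZr).
  by rewrite (dot_sym (v x) (v1 x) A_sym) (dotC (v1 x) e); ring.
have H0 x : x \in `[0, L] -> H x = 0.
  move=> xL; rewrite (is_deriv_cc0 L_gt0 dH _ xL LL)//.
  by rewrite /H vL v1L sL !(dot0l, dot0r); ring.
pose W x := dot (v x) (D *m v1 x) - z x * s x.
have dW : is_deriv_cc L W
    (fun x => 2 * (dot (v1 x) (D *m v1 x) + m * (- a) * s x ^+ 2)).
  apply: eq_is_deriv_cc (is_deriv_ccB L_gt0 (dS D _ _ _ _ vv1 v12)
    (is_deriv_ccM L_gt0 zz' ss')) => x xL.
  have := H0 x xL; rewrite /H => HE.
  rewrite Dv2// !(dotDr, dotNr, dotZr) (dotC (v x) e).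
  (* The two expressions for the derivative of [W] differ by exactly [- H x]. *)
  by apply/eqP; rewrite -subr_eq0; apply/eqP; rewrite -[RHS]oppr0 -[in RHS]HE; ring.
have D_ge0 x : 0 <= dot (v1 x) (D *m v1 x) by exact: posdef_semi.
have s_ge0 x : 0 <= m * (- a) * s x ^+ 2.
  by rewrite mulr_ge0 ?sqr_ge0// mulr_ge0 ?oppr_ge0// ltW.
have W0 : W 0 = W L.
  rewrite /W s0 sL vL dot0l !mulr0 !subr0.
  by case: v0 => ->; rewrite ?mulmx0 ?dot0l ?dot0r.
have dW_ge0 : {in `[0, L], forall x,
    0 <= 2 * (dot (v1 x) (D *m v1 x) + m * (- a) * s x ^+ 2)}.
  by move=> x _; rewrite mulr_ge0// addr_ge0.
move=> x xL; apply: (posdef_eq0 D_pos); apply/eqP.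
have /eqP := is_deriv_cc_ge0_eq0 L_gt0 dW dW_ge0 W0 xL.
by rewrite mulf_eq0 pnatr_eq0/= paddr_eq0// => /andP[].
Qed.

Lemma clamped_trivial (v v1 v2 : R -> 'cV[R]_p) (s z : R -> R) :
  is_vderiv_cc L v v1 -> is_vderiv_cc L v1 v2 ->
  is_deriv_cc L s (fun x => dot e (v x)) ->
  is_deriv_cc L z (fun x => m * (a * s x)) ->
  {in `[0, L], forall x, D *m v2 x = (C + a *: M) *m v x - z x *: e} ->
  s 0 = 0 -> v 0 = 0 -> s L = 0 -> v L = 0 -> v1 L = 0 ->
  {in `[0, L], forall x, s x = 0 /\ v x = 0}.
Proof.
move=> vv1 v12 ss' zz' Dv2 s0 v0 sL vL v1L.
have v1_0 := hamiltonian_rigidity vv1 v12 ss' zz' Dv2 s0 (or_introl v0) sL vL v1L.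
have v_0 x : x \in `[0, L] -> v x = 0.
  by move=> xL; rewrite (is_vderiv_cc0 L_gt0 vv1 v1_0 xL LL).
move=> x xL; split; last exact: v_0.
rewrite -s0; apply: (is_deriv_cc0 L_gt0 ss') => // y yL.
by rewrite v_0// dot0r.
Qed.

(* [v2, v3, v4] with displacement [dot e v1] and resultant [m * a * dot e v]
   again solve the system, and satisfy the boundary conditions needed. *)
Lemma hinged_trivial (v v1 v2 v3 v4 : R -> 'cV[R]_p) (s z : R -> R) :
  is_vderiv_cc L v v1 -> is_vderiv_cc L v1 v2 ->
  is_vderiv_cc L v2 v3 -> is_vderiv_cc L v3 v4 ->
  is_deriv_cc L s (fun x => dot e (v x)) ->
  is_deriv_cc L z (fun x => m * (a * s x)) ->
  {in `[0, L], forall x, D *m v2 x = (C + a *: M) *m v x - z x *: e} ->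
  s 0 = 0 -> v1 0 = 0 -> s L = 0 -> v1 L = 0 -> v2 L = 0 ->
  {in `[0, L], forall x, s x = 0 /\ v1 x = 0}.
Proof.
move=> vv1 v12 v23 v34 ss' zz' Dv2 s0 v10 sL v1L v2L.
have Dv3 : {in `[0, L], forall x,
    D *m v3 x = (C + a *: M) *m v1 x - (m * (a * s x)) *: e}.
  (* The system is differentiated: its two sides agree on the segment, hence so do their relative
     derivatives. *)
  apply: (is_vderiv_cc_unique L_gt0 (is_vderiv_cc_mulmx (A := D) L_gt0 v23)).
  apply: (eq_is_vderiv_ccl _ (is_vderiv_ccB L_gt0
    (is_vderiv_cc_mulmx L_gt0 vv1) (is_vderiv_ccZ (e := e) L_gt0 zz'))).
  by move=> x xL; rewrite Dv2.
have dmas : is_deriv_cc L (fun x => m * (a * s x))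
    (fun x => m * (a * dot e (v x))).
  exact: is_deriv_ccZ (is_deriv_ccZ L_gt0 ss').
have Dv4 : {in `[0, L], forall x,
    D *m v4 x = (C + a *: M) *m v2 x - (m * (a * dot e (v x))) *: e}.
  apply: (is_vderiv_cc_unique L_gt0 (is_vderiv_cc_mulmx (A := D) L_gt0 v34)).
  apply: (eq_is_vderiv_ccl _ (is_vderiv_ccB L_gt0
    (is_vderiv_cc_mulmx L_gt0 v12) (is_vderiv_ccZ (e := e) L_gt0 dmas))).
  by move=> x xL; rewrite Dv3.
(* The differentiated equation supplies the third-order end conditions: where [v1] and [s] vanish,
   so does [D *m v3 x]. *)
have v3_0 x : x \in `[0, L] -> v1 x = 0 -> s x = 0 -> v3 x = 0.
  move=> xL v1x sx; apply: (posdef_eq0 D_pos).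
  by rewrite Dv3// v1x sx !mulr0 scale0r mulmx0 subr0 dot0r.
have v3_eq0 : {in `[0, L], forall x, v3 x = 0}.
  apply: (@hamiltonian_rigidity v2 v3 v4 (fun x => dot e (v1 x))
    (fun x => m * (a * dot e (v x)))) => //.
  - exact: is_deriv_cc_dotl.
  - exact: is_deriv_ccZ (is_deriv_ccZ L_gt0 (is_deriv_cc_dotl L_gt0 vv1)).
  - by rewrite v10 dot0r.
  - by right; exact: v3_0.
  - by rewrite v1L dot0r.
  - exact: v3_0.
have v2_eq0 x : x \in `[0, L] -> v2 x = 0.
  by move=> xL; rewrite (is_vderiv_cc0 L_gt0 v23 v3_eq0 xL LL).
have v1_eq0 x : x \in `[0, L] -> v1 x = 0.
  by move=> xL; rewrite (is_vderiv_cc0 L_gt0 v12 v2_eq0 xL LL).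
have vE x : x \in `[0, L] -> v x = v 0.
  by move=> xL; exact: (is_vderiv_cc0 L_gt0 vv1 v1_eq0 xL zeroL).
(* Now [v] is constant, so [s] has constant slope [c]. Its equal end values give [c = 0], again
   after multiplication by [c] to obtain a sign. *)
pose c := dot e (v 0).
have ds : is_deriv_cc L s (fun=> c).
  by apply: eq_is_deriv_cc ss' => x xL; rewrite vE.
have c0 : c = 0.
  have : {in `[0, L], forall x : R, c * c = 0}.
    apply: (is_deriv_cc_ge0_eq0 L_gt0 (is_deriv_ccZ (a := c) L_gt0 ds)) => [x _|].
      by rewrite -expr2 sqr_ge0.
    by rewrite s0 sL.
  by move=> /(_ 0 zeroL)/eqP; rewrite mulf_eq0 orbb => /eqP.
move=> x xL; split; last exact: v1_eq0.
by rewrite -s0; apply: (is_deriv_cc0 L_gt0 ds).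
Qed.

End QuadraticSystem.

(** * Reduction of the complex problem to the real system *)

Section RealParts.
Variable R : realType.
Implicit Types (p q r : R) (z w : R[i]).

(* Every R-linear functional of R[i] is of this form. *)
Definition part p q z : R := p * complex.Re z + q * complex.Im z.

Lemma partD p q z w : part p q (z + w) = part p q z + part p q w.
Proof. by case: z w => [x y] [x' y']; rewrite /part/=; ring. Qed.

Lemma partN p q z : part p q (- z) = - part p q z.
Proof. by case: z => [x y]; rewrite /part/=; ring. Qed.

Lemma part0 p q : part p q 0 = 0.
Proof. by rewrite /part/= !mulr0 addr0. Qed.

Lemma part_realM p q r z : part p q (r%:C * z) = r * part p q z.
Proof. by case: z => [x y]; rewrite /part/=; ring. Qed.

(** Multiplication by [z] followed by a real-linear functional is again such a functional; with [z]
    the squared eigenvalue, its coefficients are the [p'] and [q'] of [state_equation]. *)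
Lemma partM p q z w : part p q (z * w) =
  part (part p q z) (q * complex.Re z - p * complex.Im z) w.
Proof. by case: z w => [x y] [x' y']; rewrite /part/=; ring. Qed.

Lemma part_comb r s p q p' q' z :
  part (r * p + s * p') (r * q + s * q') z =
  r * part p q z + s * part p' q' z.
Proof. by rewrite /part; ring. Qed.

Lemma part_Re z : part 1 0 z = complex.Re z.
Proof. by rewrite /part mul1r mul0r addr0. Qed.

Lemma part_Im z : part 0 1 z = complex.Im z.
Proof. by rewrite /part mul1r mul0r add0r. Qed.

Lemma part_eq z w : (forall p q, part p q z = part p q w) -> z = w.
Proof.
move=> zw; apply/eqP; rewrite eq_complex.
by rewrite -!part_Re -!part_Im !zw !eqxx.
Qed.

Lemma map_part_mulmx p q k l j (A : 'M[R]_(k, l)) (X : 'M[R[i]]_(l, j)) :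
  map_mx (part p q) (toC A *m X) = A *m map_mx (part p q) X.
Proof.
apply/matrixP => s t; rewrite !mxE.
rewrite (big_morph (part p q) (partD p q) (part0 p q)).
by apply: eq_bigr => i _; rewrite !mxE part_realM.
Qed.

Lemma map_partD p q k j (X Y : 'M[R[i]]_(k, j)) :
  map_mx (part p q) (X + Y) = map_mx (part p q) X + map_mx (part p q) Y.
Proof. by apply/matrixP => s t; rewrite !mxE partD. Qed.

Lemma map_partN p q k j (X : 'M[R[i]]_(k, j)) :
  map_mx (part p q) (- X) = - map_mx (part p q) X.
Proof. by apply/matrixP => s t; rewrite !mxE partN. Qed.

Lemma map_part_scale p q k j z (A : 'M[R]_(k, j)) :
  map_mx (part p q) (z *: toC A) = part p q z *: A.
Proof. by apply/matrixP => s t; rewrite !mxE mulrC part_realM mulrC. Qed.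

Lemma map_part0 p q k j : map_mx (part p q) (0 : 'M[R[i]]_(k, j)) = 0.
Proof. by apply/matrixP => s t; rewrite !mxE part0. Qed.

Lemma map_part_eq k j (X Y : 'M[R[i]]_(k, j)) :
  (forall p q, map_mx (part p q) X = map_mx (part p q) Y) -> X = Y.
Proof.
move=> XY; apply/matrixP => s t; apply: part_eq => p q.
by have /matrixP/(_ s t) := XY p q; rewrite !mxE.
Qed.

Variables (L : R).
Hypothesis L_gt0 : 0 < L.

Lemma Re_iter_cderiv k (f : R -> R[i]) x : complex.Re (iter k (cderiv L) f x) =
  iter k (deriv_cc L) (fun t => complex.Re (f t)) x.
Proof.
by elim: k x => //= k IHk x; congr deriv_cc; apply/funext => t; exact: IHk.
Qed.

Lemma Im_iter_cderiv k (f : R -> R[i]) x : complex.Im (iter k (cderiv L) f x) =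
  iter k (deriv_cc L) (fun t => complex.Im (f t)) x.
Proof.
by elim: k x => //= k IHk x; congr deriv_cc; apply/funext => t; exact: IHk.
Qed.

Lemma iter_vderivE k d (F : R -> 'cV[R[i]]_d) x i :
  iter k (@vderiv R L d) F x i 0 = iter k (cderiv L) (fun t => F t i 0) x.
Proof.
elim: k x => //= k IHk x; rewrite mxE.
by congr cderiv; apply/funext => t; exact: IHk.
Qed.

Lemma is_deriv_cc_part p q f k : csmooth L f ->
  is_deriv_cc L (fun x => part p q (iter k (cderiv L) f x))
    (fun x => part p q (iter k.+1 (cderiv L) f x)).
Proof.
move=> [fRe fIm].
apply: (eq_is_deriv_ccl (f := fun x =>
  p * iter k (deriv_cc L) (fun t => complex.Re (f t)) x +
  q * iter k (deriv_cc L) (fun t => complex.Im (f t)) x)) => [x _|].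
  by rewrite /part Re_iter_cderiv Im_iter_cderiv.
apply: eq_is_deriv_cc (is_deriv_ccD L_gt0
   (is_deriv_ccZ (a := p) L_gt0 (smooth_is_deriv_cc (k := k) fRe))
   (is_deriv_ccZ (a := q) L_gt0 (smooth_is_deriv_cc (k := k) fIm))) => x _.
by rewrite /part Re_iter_cderiv Im_iter_cderiv.
Qed.

Lemma is_vderiv_cc_part p q d (F : R -> 'cV[R[i]]_d) k : vsmooth L F ->
  is_vderiv_cc L (fun x => map_mx (part p q) (iter k (@vderiv R L d) F x))
    (fun x => map_mx (part p q) (iter k.+1 (@vderiv R L d) F x)).
Proof.
move=> Fs i; apply: eq_is_deriv_ccl => [x _|]; first by rewrite !mxE iter_vderivE.
apply: eq_is_deriv_cc (is_deriv_cc_part (p := p) (q := q) (k := k) (Fs i)).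
by move=> x _; rewrite [RHS]mxE iter_vderivE.
Qed.

(** The functionals [part 1 0] and [part 0 1] recover real and imaginary parts. Used to compute the
    derivative of [phiE], about which no smoothness is assumed directly. *)
Lemma vderivE d (F F' : R -> 'cV[R[i]]_d) :
  (forall p q, is_vderiv_cc L (fun x => map_mx (part p q) (F x))
     (fun x => map_mx (part p q) (F' x))) ->
  {in `[0, L], vderiv L F =1 F'}.
Proof.
move=> FF' x xL; apply/colP => i; rewrite mxE /cderiv.
have e p q : deriv_cc L (fun t => part p q (F t i 0)) x = part p q (F' x i 0).
  rewrite (deriv_ccE L_gt0 (f' := fun t => part p q (F' t i 0)))//.
  apply: (eq_is_deriv_ccl (f := fun t => map_mx (part p q) (F t) i 0)) => [t _|].
    by rewrite mxE.
  by apply: eq_is_deriv_cc (FF' p q i) => t _; rewrite mxE.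
have := e 1 0; have := e 0 1.
under [X in deriv_cc _ X]eq_fun do rewrite part_Im; rewrite part_Im => ->.
under [X in deriv_cc _ X]eq_fun do rewrite part_Re; rewrite part_Re => ->.
by case: (F' x i 0).
Qed.

End RealParts.

(** * Block matrices of the abstract system *)

Section BlockForm.
Variables (R : realType) (n : nat).

(** The vector [w = (u', U)], with the slope as first component. *)
Definition stateO (c : R) (V : 'cV[R]_n.+1) : 'cV[R]_(1 + n.+1) :=
  col_mx c%:M V.

Definition dirO : 'cV[R]_(1 + n.+1) := stateO 1 0.

(** Both [D], as [blockO K h E], and [M], as [blockO alpha rho h], have this form. *)
Definition blockO (k : R) (c d : nat -> R) : 'M[R]_(1 + n.+1) :=
  diag_mx (row_mx (const_mx k) (\row_(j < n.+1) (c j.*2.+1 * d j.*2.+1))).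

(** The matrix that sends [w] to [phi_E]. *)
Definition shear (h : nat -> R) : 'M[R]_(n, 1 + n.+1) :=
  row_mx (vecN n h) (invmx (diagE n h) *m matB R n).

(** The matrix [C]; its quadratic form is the shear energy of the even layers. *)
Definition shearE (h G : nat -> R) : 'M[R]_(1 + n.+1) :=
  (shear h)^T *m (diagE n h *m diagE n G) *m shear h.

Lemma dot_dirO c V : dot dirO (stateO c V) = c.
Proof.
rewrite /dot /dirO /stateO tr_col_mx mul_row_col trmx0 mul0mx addr0.
by rewrite tr_scalar_mx mul1mx mxE.
Qed.

Lemma diagOM (c d : nat -> R) : diagO n c *m diagO n d =
  diag_mx (\row_(j < n.+1) (c j.*2.+1 * d j.*2.+1)).
Proof. by rewrite mulmx_diag; congr diag_mx; apply/rowP => j; rewrite !mxE. Qed.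

Lemma mul_blockO k c d a V : blockO k c d *m stateO a V =
  stateO (k * a) (diagO n c *m diagO n d *m V).
Proof.
rewrite /blockO diag_mx_row mul_block_col !mul0mx addr0 add0r.
by rewrite diag_const_mx -scalar_mxM diagOM.
Qed.

Lemma blockO_posdef k c d : 0 < k -> (forall j, (j < n.+1)%N ->
  0 < c j.*2.+1 * d j.*2.+1) -> posdef (blockO k c d).
Proof.
move=> k_gt0 cd_gt0; apply: posdef_diag => i.
by case: (split_ordP i) => j ->; rewrite (row_mxEl, row_mxEr) mxE// cd_gt0.
Qed.

Lemma mul_shear h a V : shear h *m stateO a V =
  a *: vecN n h + invmx (diagE n h) *m matB R n *m V.
Proof. by rewrite mul_row_col mul_mx_scalar. Qed.

Lemma diagE_sym (c d : nat -> R) :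
  (diagE n c *m diagE n d)^T = diagE n c *m diagE n d.
Proof. by rewrite mulmx_diag tr_diag_mx. Qed.

Lemma shearE_sym h G : (shearE h G)^T = shearE h G.
Proof. by rewrite /shearE !trmx_mul trmxK -trmx_mul diagE_sym mulmxA. Qed.

Lemma shearE_possemidef h G :
  (forall j, (j < n)%N -> 0 <= h j.*2.+2 * G j.*2.+2) ->
  possemidef (shearE h G).
Proof.
move=> hG_ge0 v.
have -> : dot v (shearE h G *m v) =
    dot (shear h *m v) (diagE n h *m diagE n G *m (shear h *m v)).
  by rewrite /dot /shearE trmx_mul !mulmxA.
by rewrite mulmx_diag; apply: possemidef_diag => i; rewrite !mxE hG_ge0.
Qed.

(** The blocks are the shear terms of the two equations: in the second one the inverse of
    [diagE n h] inside [shear] cancels the factor [diagE n h], which is invertible as its entries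
    are positive. *)
Lemma tr_shear_mul h G (phi : 'cV[R]_n) :
  (forall j, (j < n)%N -> 0 < h j.*2.+2) ->
  (shear h)^T *m (diagE n h *m diagE n G) *m phi =
  stateO (((vecN n h)^T *m diagE n h *m diagE n G *m phi) 0 0)
    ((matB R n)^T *m diagE n G *m phi).
Proof.
move=> h_gt0; rewrite /shear tr_row_mx !mul_col_mx; congr col_mx.
  by rewrite [LHS]mx11_scalar !mulmxA.
have h_unit : diagE n h \in unitmx.
  rewrite unitmxE det_diag unitfE; apply/prodf_neq0 => i _.
  by rewrite mxE gt_eqF// h_gt0.
rewrite trmx_mul trmx_inv tr_diag_mx -/(diagE n h) !mulmxA.
by rewrite -[_ *m invmx _ *m _]mulmxA mulVmx// mulmx1.
Qed.

Lemma stateOD a b V W : stateO a V + stateO b W = stateO (a + b) (V + W).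
Proof. by rewrite /stateO add_col_mx raddfD. Qed.

Lemma stateOZ r a V : r *: stateO a V = stateO (r * a) (r *: V).
Proof. by rewrite /stateO scale_col_mx scale_scalar_mx. Qed.

Lemma stateON a V : - stateO a V = stateO (- a) (- V).
Proof. by rewrite /stateO opp_col_mx raddfN. Qed.

Lemma stateO_inj a b V W : stateO a V = stateO b W -> a = b /\ V = W.
Proof.
move=> /eq_col_mx[/matrixP/(_ 0 0) + ->].
by rewrite !mxE eqxx !mulr1n.
Qed.

Lemma stateO0 : stateO 0 0 = 0.
Proof. by rewrite /stateO raddf0 col_mx0. Qed.

Lemma is_vderiv_cc_stateO L f f' F F' : is_deriv_cc L f f' ->
  is_vderiv_cc L F F' ->
  is_vderiv_cc L (fun x => stateO (f x) (F x)) (fun x => stateO (f' x) (F' x)).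
Proof.
move=> ff' FF' i; case: (split_ordP i) => j ->.
  apply: eq_is_deriv_ccl => [x _|]; first by rewrite col_mxEu ord1 mxE mulr1n.
  by apply: eq_is_deriv_cc ff' => x _; rewrite col_mxEu ord1 mxE mulr1n.
apply: eq_is_deriv_ccl => [x _|]; first by rewrite col_mxEd.
by apply: eq_is_deriv_cc (FF' j) => x _; rewrite col_mxEd.
Qed.

End BlockForm.

(** * From the eigenvalue problem to the second-order system *)

Section StateEquation.
Variables (R : realType) (n : nat) (L m alpha K : R) (h rho E G : nat -> R).
Variables (lambda : R[i]) (u : R -> R[i]) (U : R -> 'cV[R[i]]_n.+1).
Hypotheses (L_gt0 : 0 < L) (u_smooth : csmooth L u) (U_smooth : vsmooth L U).
Hypothesis h_gt0 : forall j, (j < n)%N -> 0 < h j.*2.+2.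
Hypothesis eq_u : forall x, x \in `]0, L[ ->
  - K%:C * iter 4 (cderiv L) u x
  + (toC ((vecN n h)^T *m diagE n h *m diagE n G)
       *m vderiv L (phiE L h u U) x) 0 0
  = lambda ^+ 2 * (m%:C * u x - alpha%:C * iter 2 (cderiv L) u x).
Hypothesis eq_U : forall x, x \in `]0, L[ ->
  toC (diagO n h *m diagO n E) *m iter 2 (@vderiv R L n.+1) U x
  - toC ((matB R n)^T *m diagE n G) *m phiE L h u U x
  = lambda ^+ 2 *: (toC (diagO n rho *m diagO n h) *m U x).

(** A functional of the [k]-th derivative of [w]; the shift [k.+1] is due to the first component
    being [u']. *)
Definition state p q k x : 'cV[R]_(1 + n.+1) :=
  stateO (part p q (iter k.+1 (cderiv L) u x))
    (map_mx (part p q) (iter k (@vderiv R L n.+1) U x)).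

Lemma state_comb r s p q p' q' k x :
  state (r * p + s * p') (r * q + s * q') k x =
  r *: state p q k x + s *: state p' q' k x.
Proof.
rewrite /state !stateOZ stateOD part_comb; congr stateO.
by apply/colP => i; rewrite !mxE part_comb.
Qed.

Lemma is_vderiv_cc_state p q k :
  is_vderiv_cc L (state p q k) (state p q k.+1).
Proof.
apply: is_vderiv_cc_stateO; first exact: is_deriv_cc_part.
exact: is_vderiv_cc_part.
Qed.

Lemma is_deriv_cc_displacement p q : is_deriv_cc L (fun x => part p q (u x))
  (fun x => dot (dirO R n) (state p q 0 x)).
Proof.
apply: eq_is_deriv_cc (is_deriv_cc_part (k := 0) L_gt0 u_smooth) => x _.
by rewrite dot_dirO.
Qed.

Lemma part_phiE p q x :
  map_mx (part p q) (phiE L h u U x) = shear n h *m state p q 0 x.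
Proof.
by rewrite map_partD map_part_mulmx map_part_scale mul_shear addrC.
Qed.

Lemma part_vderiv_phiE p q x : x \in `[0, L] ->
  map_mx (part p q) (vderiv L (phiE L h u U) x) = shear n h *m state p q 1 x.
Proof.
move=> xL; pose F' t := toC (invmx (diagE n h) *m matB R n) *m vderiv L U t
  + iter 2 (cderiv L) u t *: toC (vecN n h).
have F'E r s t : map_mx (part r s) (F' t) = shear n h *m state r s 1 t.
  by rewrite map_partD map_part_mulmx map_part_scale mul_shear addrC.
rewrite -F'E (vderivE L_gt0 (F' := F'))// => r s.
apply: eq_is_vderiv_ccl => [t _|]; first by rewrite part_phiE.
have := is_vderiv_cc_mulmx (A := shear n h) L_gt0 (@is_vderiv_cc_state r s 0).
by move=> d i; apply: eq_is_deriv_cc (d i) => t _; rewrite F'E.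
Qed.

(** The resultant [z] turns the fourth-order equation into a second-order one: the first row defines
    [z], and the equation for [u] becomes the formula for its derivative. A non-real squared
    eigenvalue couples the functional [(p, q)] to [(p', q')]. *)
Lemma state_equation p q (p' := part p q (lambda ^+ 2))
    (q' := q * complex.Re (lambda ^+ 2) - p * complex.Im (lambda ^+ 2)) :
  exists z : R -> R,
    is_deriv_cc L z (fun x => m * part p' q' (u x)) /\
    {in `[0, L], forall x, blockO n K h E *m state p q 2 x =
       shearE n h G *m state p q 0 x + blockO n alpha rho h *m state p' q' 0 x
       - z x *: dirO R n}.
Proof.
pose A := (vecN n h)^T *m diagE n h *m diagE n G *m shear n h.
have dA k : is_deriv_cc L (fun x => (A *m state p q k x) 0 0)
    (fun x => (A *m state p q k.+1 x) 0 0).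
  exact: (is_vderiv_cc_mulmx (A := A) L_gt0 (@is_vderiv_cc_state p q k)).
(* The [k]-th derivative of the resultant. *)
pose Z k x := (A *m state p q k x) 0 0
  + alpha * part p' q' (iter k.+1 (cderiv L) u x)
  - K * part p q (iter k.+3 (cderiv L) u x).
have dZ k : is_deriv_cc L (Z k) (Z k.+1).
  apply: (is_deriv_ccB L_gt0 (is_deriv_ccD L_gt0 (dA k) _)).
  - exact: is_deriv_ccZ (is_deriv_cc_part L_gt0 u_smooth).
  - exact: is_deriv_ccZ (is_deriv_cc_part L_gt0 u_smooth).
have Z1E : {in `[0, L], forall x, Z 1 x - m * part p' q' (u x) = 0}.
  apply: (is_deriv_cc_eq_cc L_gt0 (is_deriv_ccB L_gt0 (dZ 1%N)
    (is_deriv_ccZ L_gt0 (@is_deriv_cc_displacement p' q')))) => x xL.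
  have := congr1 (part p q) (eq_u xL).
  rewrite partM -/p' -/q' !(partD, partN) mulNr !(partN, part_realM).
  have partA (X : 'cV[R[i]]_1) : part p q (X 0 0) = map_mx (part p q) X 0 0.
    by rewrite mxE.
  rewrite partA map_part_mulmx part_vderiv_phiE ?mulmxA; last first.
    exact: subset_itv_oo_cc xL.
  by rewrite /Z => eqx; apply/eqP; rewrite subr_eq0; apply/eqP; lra.
(* The residual of the equation for [U]: zero inside, hence on the whole segment. *)
pose B x := diagO n h *m diagO n E *m map_mx (part p q) (iter 2 (@vderiv R L n.+1) U x)
   - (matB R n)^T *m diagE n G *m (shear n h *m state p q 0 x)
   - diagO n rho *m diagO n h *m map_mx (part p' q') (U x).
have BE : {in `[0, L], forall x, B x = 0}.
  have dU r s k := is_vderiv_cc_part (p := r) (q := s) (k := k) L_gt0 U_smooth.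
  have dB := is_vderiv_ccB L_gt0 (is_vderiv_ccB L_gt0
    (is_vderiv_cc_mulmx (A := diagO n h *m diagO n E) L_gt0 (dU p q 2%N))
    (is_vderiv_cc_mulmx (A := (matB R n)^T *m diagE n G) L_gt0
       (is_vderiv_cc_mulmx (A := shear n h) L_gt0 (@is_vderiv_cc_state p q 0))))
    (is_vderiv_cc_mulmx (A := diagO n rho *m diagO n h) L_gt0 (dU p' q' 0%N)).
  move=> x xL; apply/colP => i; rewrite [RHS]mxE.
  apply: (is_deriv_cc_eq_cc L_gt0 (dB i)) xL => y yL.
  rewrite /B; have /(congr1 (map_mx (part p q))) := eq_U yL.
  rewrite map_partD map_partN !map_part_mulmx part_phiE.
  rewrite (_ : map_mx _ (_ *: _) =
      diagO n rho *m diagO n h *m map_mx (part p' q') (U y)); last first.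
    rewrite -map_part_mulmx; apply/matrixP => s t.
    by rewrite mxE [in LHS]mxE [RHS]mxE partM.
  by move=> ->; rewrite subrr mxE.
exists (Z 0%N); split.
  apply: eq_is_deriv_cc (dZ 0%N) => x xL.
  by apply/eqP; rewrite -subr_eq0 Z1E.
move=> x xL; rewrite /shearE !mulmxA -[_ *m shear n h *m _]mulmxA.
rewrite -(mulmxA (shear n h)^T) tr_shear_mul// !mul_blockO.
rewrite stateOD /dirO stateOZ stateON stateOD scaler0 subr0 mulr1.
(* The first row is the definition of [Z 0] solved for the third derivative of [u]; the second is
   [B x = 0]. *)
congr stateO.
- by rewrite /Z /A /= -!mulmxA; ring.
- have /eqP := BE x xL; rewrite /B -addrA -opprD subr_eq0 => /eqP ->.
  by [].
Qed.

End StateEquation.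

(** * Boundary conditions and conclusion *)

Lemma vintegral_cst0 (R : realType) (L : R) d (F : R -> 'cV[R[i]]_d) c :
  0 < L -> {in `[0, L], forall x, F x = c} -> vintegral L F = 0 -> c = 0.
Proof.
move=> L_gt0 Fc /colP F0; apply/colP => i; have := F0 i; rewrite !mxE.
have int_cst (f : R[i] -> R) :
    Rintegral lebesgue_measure `]0, L[ (fun t => f (F t i 0)) = f (c i 0) * L.
  rewrite (@eq_Rintegral _ _ _ _ _ (fun=> f (c i 0))) => [|x]; last first.
    by rewrite inE => xL; rewrite Fc//; exact: subset_itv_oo_cc xL.
  rewrite Rintegral_cst//= lebesgue_measure_itv/= lte_fin L_gt0.
  by rewrite sube0.
rewrite !int_cst => -[/eqP + /eqP].
rewrite !mulf_eq0 (gt_eqF L_gt0) !orbF => /eqP cRe /eqP cIm.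
by apply/eqP; rewrite eq_complex cRe cIm !eqxx.
Qed.

Theorem lemma4p1 (R : realType) (n : nat) (L m alpha K : R)
    (h rho E G : nat -> R) (lambda : R[i])
    (u : R -> R[i]) (U : R -> 'cV[R[i]]_n.+1)
    (n_ge1 : (1 <= n)%N) (L_gt0 : 0 < L)
    (m_gt0 : 0 < m) (alpha_gt0 : 0 < alpha) (K_gt0 : 0 < K)
    (h_gt0 : forall i, (1 <= i <= 2 * n + 1)%N -> 0 < h i)
    (rho_gt0 : forall i, (1 <= i <= 2 * n + 1)%N -> odd i -> 0 < rho i)
    (E_gt0 : forall i, (1 <= i <= 2 * n + 1)%N -> odd i -> 0 < E i)
    (G_ge0 : forall i, (1 <= i <= 2 * n + 1)%N -> ~~ odd i -> 0 <= G i)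
    (u_smooth : csmooth L u) (U_smooth : vsmooth L U)
    (eq_u : forall x, x \in `]0, L[ ->
       - K%:C * iter 4 (cderiv L) u x
       + (toC ((vecN n h)^T *m diagE n h *m diagE n G)
            *m vderiv L (phiE L h u U) x) 0 0
       = lambda ^+ 2 * (m%:C * u x - alpha%:C * iter 2 (cderiv L) u x))
    (eq_U : forall x, x \in `]0, L[ ->
       toC (diagO n h *m diagO n E) *m iter 2 (@vderiv R L n.+1) U x
       - toC ((matB R n)^T *m diagE n G) *m phiE L h u U x
       = lambda ^+ 2 *: (toC (diagO n rho *m diagO n h) *m U x))
    (boundary :
       (* (h-N) *)
       ([/\ u 0 = 0, iter 2 (cderiv L) u 0 = 0, u L = 0,
            iter 2 (cderiv L) u L = 0 & iter 3 (cderiv L) u L = 0] /\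
        [/\ vderiv L U 0 = 0, vderiv L U L = 0,
            iter 2 (@vderiv R L n.+1) U L = 0 & vintegral L U = 0])
       \/
       (* (c-D), (m-m) *)
       ([/\ u 0 = 0, cderiv L u 0 = 0, u L = 0, cderiv L u L = 0
          & iter 2 (cderiv L) u L = 0] /\
        [/\ U 0 = 0, U L = 0 & vderiv L U L = 0])) :
  forall x, x \in `[0, L] -> u x = 0 /\ U x = 0.
Proof.
have h2_gt0 j : (j < n)%N -> 0 < h j.*2.+2 by move=> jn; apply: h_gt0; lia.
have odd_ltn j : (j < n.+1)%N -> (1 <= j.*2.+1 <= 2 * n + 1)%N by lia.
have D_pos : posdef (blockO n K h E).
  by apply: blockO_posdef => // j /odd_ltn jn;
    rewrite mulr_gt0 ?h_gt0 ?E_gt0//= odd_double.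
have M_pos : posdef (blockO n alpha rho h).
  by apply: blockO_posdef => // j /odd_ltn jn;
    rewrite mulr_gt0 ?h_gt0 ?rho_gt0//= odd_double.
have C_pos : possemidef (shearE n h G).
  apply: shearE_possemidef => j jn.
  have jle : (1 <= j.*2.+2 <= 2 * n + 1)%N by lia.
  by rewrite mulr_ge0//; [exact/ltW/h_gt0|rewrite G_ge0//= odd_double].
have block_sym k c d : (blockO n k c d : 'M[R]_(1 + n.+1))^T = blockO n k c d.
  by rewrite tr_diag_mx.
have C_sym := @shearE_sym R n h G.
pose a := complex.Re (lambda ^+ 2); pose b := complex.Im (lambda ^+ 2).
have eqn := state_equation L_gt0 u_smooth U_smooth h2_gt0 eq_u eq_U.
have dst p q k := is_vderiv_cc_state L_gt0 u_smooth U_smooth (p := p) (q := q) (k := k).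
have dsp p q := is_deriv_cc_displacement L_gt0 u_smooth (U := U) (p := p) (q := q).
(* The coupled functional is written as a combination of [(p, q)] and a chosen [(p', q')]: with
   [s = 0] for a real squared eigenvalue, and with [(1, 0)] and [(0, 1)] exchanging roles for the
   pair of real and imaginary parts. *)
have {}eqn p q r s p' q' : part p q (lambda ^+ 2) = r * p + s * p' ->
    q * a - p * b = r * q + s * q' ->
    exists z : R -> R,
    is_deriv_cc L z (fun x => m * (r * part p q (u x) + s * part p' q' (u x))) /\
    {in `[0, L], forall x, blockO n K h E *m state L u U p q 2 x =
       shearE n h G *m state L u U p q 0 x
       + (r *: (blockO n alpha rho h *m state L u U p q 0 x)
          + s *: (blockO n alpha rho h *m state L u U p' q' 0 x))
       - z x *: dirO R n}.
  move=> E1 E2; have [z [dz Ez]] := eqn p q; exists z; split.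
    by apply: eq_is_deriv_cc dz => x _; rewrite E1 E2 part_comb.
  by move=> x xL; rewrite Ez// E1 E2 state_comb mulmxDr -!scalemxAr.
have zeroL : 0 \in `[0, L] by rewrite in_itv/= lexx ltW.
have stateE p q k x : iter k.+1 (cderiv L) u x = 0 ->
    iter k (@vderiv R L n.+1) U x = 0 -> state L u U p q k x = 0.
  by move=> uE UE; rewrite /state uE UE part0 map_part0 stateO0.
have u_ends x : x = 0 \/ x = L -> u x = 0.
  by case: boundary => [[[u0 _ uL _ _] _]|[[u0 _ uL _ _] _]] [] ->.
(* The hinged conditions annihilate [(u'', U')] at both ends, the clamped ones [(u', U)]. *)
have state_ends x : x = 0 \/ x = L ->
    (forall p q, state L u U p q 0 x = 0) \/
    (forall p q, state L u U p q 1 x = 0).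
  case: boundary => [[[_ u0 _ uL _] [U0 UL _ _]]|[[_ u0 _ uL _] [U0 UL _]]] [] ->.
  - by right => p q; exact: stateE.
  - by right => p q; exact: stateE.
  - by left => p q; exact: stateE.
  - by left => p q; exact: stateE.
have trivial_of_parts x :
    (forall p q, part p q (u x) = 0 /\ map_mx (part p q) (U x) = 0) ->
    u x = 0 /\ U x = 0.
  move=> e; split.
    by apply: part_eq => p q; rewrite part0; case: (e p q).
  by apply: map_part_eq => p q; rewrite map_part0; case: (e p q).
have real_case : b = 0 -> a <= 0 -> {in `[0, L], forall x, u x = 0 /\ U x = 0}.
  move=> b0 a_le0.
  have real_eqn p q : exists z : R -> R,
      is_deriv_cc L z (fun x => m * (a * part p q (u x))) /\
      {in `[0, L], forall x, blockO n K h E *m state L u U p q 2 x =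
         (shearE n h G + a *: blockO n alpha rho h) *m state L u U p q 0 x
         - z x *: dirO R n}.
    have [||z [dz Ez]] := eqn p q a 0 0 0.
    - by rewrite /part -/a -/b b0; ring.
    - by rewrite b0; ring.
    exists z; split; first by apply: eq_is_deriv_cc dz => x _; rewrite mul0r addr0.
    by move=> x xL; rewrite Ez// scale0r addr0 mulmxDl scalemxAl.
  case: boundary => [[[u0 u20 uL u2L u3L] [U10 U1L U2L intU]]|
    [[u0 u10 uL u1L u2L] [U0 UL U1L]]].
  - have triv p q x : x \in `[0, L] -> part p q (u x) = 0 /\
        map_mx (part p q) (vderiv L U x) = 0.
      move=> xL; have [z [dz Ez]] := real_eqn p q.
      have [-> ] := hinged_trivial L_gt0 (block_sym K h E) D_pos C_sym
        (block_sym alpha rho h) m_gt0 a_le0 (dst p q 0%N) (dst p q 1%N)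
        (dst p q 2%N) (dst p q 3%N) (dsp p q) dz Ez
        (etrans (congr1 _ u0) (part0 p q)) (stateE _ _ _ _ u20 U10)
        (etrans (congr1 _ uL) (part0 p q)) (stateE _ _ _ _ u2L U1L)
        (stateE _ _ _ _ u3L U2L) xL.
      by rewrite -[X in _ = X]stateO0 => /stateO_inj[].
    (* In the hinged case the system yields only [U' = 0]; the zero mean then excludes a rigid
       translation. *)
    have U_cst : {in `[0, L], forall x, U x = U 0}.
      move=> x xL; apply: map_part_eq => p q.
      apply: (is_vderiv_cc0 L_gt0 (is_vderiv_cc_part (p := p) (q := q) (k := 0%N)
        L_gt0 U_smooth)) => // t tL.
      by have [] := triv p q t tL.
    move=> x xL; rewrite U_cst// (vintegral_cst0 L_gt0 U_cst intU).
    split=> //; apply: part_eq => p q.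
    by rewrite part0; have [] := triv p q x xL.
  - move=> x xL; apply: trivial_of_parts => p q.
    have [z [dz Ez]] := real_eqn p q.
    have [-> ] := clamped_trivial L_gt0 (block_sym K h E) D_pos C_sym
      (block_sym alpha rho h) m_gt0 a_le0 (dst p q 0%N) (dst p q 1%N) (dsp p q) dz Ez
      (etrans (congr1 _ u0) (part0 p q)) (stateE p q 0%N _ u10 U0)
      (etrans (congr1 _ uL) (part0 p q)) (stateE p q 0%N _ u1L UL)
      (stateE p q 1%N _ u2L U1L) xL.
    by rewrite -[X in _ = X]stateO0 => /stateO_inj[].
(* The resultants of the real and imaginary parts, in the form required by [spectrum_real_le0]. *)
have [||y [dy Ey]] := eqn 1 0 a (- b) 0 1.
- by rewrite part_Re; ring.
- by ring.
have [||z [dz Ez]] := eqn 0 1 a b 1 0.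
- by rewrite part_Im; ring.
- by ring.
have [|||||[b0 a_le0]|triv] := spectrum_real_le0 L_gt0 (block_sym K h E) D_pos
  C_sym C_pos (block_sym alpha rho h) M_pos m_gt0 (a := a) (b := b)
  (dst 1 0 0%N) (dst 1 0 1%N) (dst 0 1 0%N) (dst 0 1 1%N) (dsp 1 0) (dsp 0 1)
  (y := y) (z := z) _ _ _ _ _.
- by apply: eq_is_deriv_cc dy => x _; rewrite mulNr.
- exact: dz.
- by move=> x xL; rewrite Ey// scaleNr.
- exact: Ez.
- move=> x xend; rewrite (u_ends _ xend) !part0; split=> //.
  by have [s0|s1] := state_ends x xend; [left|right]; split.
- exact: real_case.
move=> x xL; have [uRe uIm sRe sIm] := triv x xL.
(* Every functional is a combination of the real and imaginary parts, both of which vanish here. *)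
have part_ReIm p q w : part p q w = part (p * 1 + q * 0) (p * 0 + q * 1) w.
  by congr part; ring.
apply: trivial_of_parts => p q; split.
  by rewrite part_ReIm part_comb uRe uIm !mulr0 addr0.
have : state L u U (p * 1 + q * 0) (p * 0 + q * 1) 0 x = 0.
  by rewrite state_comb sRe sIm !scaler0 addr0.
rewrite !(mulr0, mulr1) addr0 add0r.
by rewrite -[X in _ = X]stateO0 => /stateO_inj[].
Qed.
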